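(* There exist absolute constants $c,C>0$ such that the following holds. Let $r\ge1$ with $r\le c\sqrt{\log n}$, and let $P_1,\dots,P_n\colon\mathbb{F}_2^m\to\mathbb{F}_2$ be functions with $\operatorname{rank}_1(P_i)\le r$ for all $i$. Let $\mathcal{P}$ be the distribution of $(P_1(X),\dots,P_n(X))$ for $X$ uniform on $\mathbb{F}_2^m$. Then \[ \|\mathcal{P}-\mathrm{Ber}(1/3)^{\otimes n}\|_{\mathtt{TV}}\ \ge\ 1-C\,\frac{2^{r/2}}{n^{1/(r+1)}}. \]
   Context: Logarithms are base 2. $\operatorname{rank}_1(P)$ is the smallest positive integer $k$ with $P=\Gamma(L_1,\dots,L_k)$ for polynomials $L_j$ of degree at most $1$ and some $\Gamma\colon\mathbb{F}_2^k\to\mathbb{F}_2$. Total variation distance: $\frac12\sum_x|\mathcal{D}_1(x)-\mathcal{D}_2(x)|$. *)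

(* Defs.v *)
From mathcomp Require Import all_boot all_order all_algebra.
From mathcomp Require Import all_classical all_reals.
From mathcomp Require Import exp.
Set Implicit Arguments. Unset Strict Implicit. Unset Printing Implicit Defensive.
Import Order.TTheory GRing.Theory Num.Theory.
Local Open Scope ring_scope.

Definition aff_eval (m : nat) (a : 'rV['F_2]_m) (c : 'F_2) (x : 'rV['F_2]_m) : 'F_2 :=
  c + \sum_(i < m) a 0 i * x 0 i.

Definition rank1_pred (m : nat) (P : 'rV['F_2]_m -> 'F_2) (k : nat) : bool :=
  (0 < k)%N &&
  [exists L : {ffun 'I_k -> 'rV['F_2]_m * 'F_2},
    exists G : {ffun 'rV['F_2]_k -> 'F_2},
      [forall x, P x == G (\row_j aff_eval (L j).1 (L j).2 x)]].

Lemma rank1_exists (m : nat) (P : 'rV['F_2]_m -> 'F_2) : exists k, rank1_pred P k.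
Proof.
exists m.+1; apply/andP; split=> //.
apply/existsP; exists [ffun j : 'I_m.+1 =>
  ((\row_(i < m) (if (i : nat) == (j : nat) then 1 else 0)) : 'rV['F_2]_m, 0 : 'F_2)].
apply/existsP; exists [ffun y : 'rV['F_2]_m.+1 =>
  P (\row_(i < m) y 0 (widen_ord (leqnSn m) i))].
apply/forallP=> x; rewrite ffunE; apply/eqP; congr P.
apply/rowP=> i; rewrite !mxE ffunE /aff_eval /= add0r.
rewrite (bigD1 i) //= !mxE eqxx mul1r big1 ?addr0 //.
move=> i' /negbTE ne; rewrite !mxE.
by case: eqP => [/val_inj e|]; [rewrite e eqxx in ne | rewrite mul0r].
Qed.

Definition rank1 (m : nat) (P : 'rV['F_2]_m -> 'F_2) : nat := ex_minn (rank1_exists P).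

Definition push_dist (R : realType) (n m : nat) (P : 'I_n -> 'rV['F_2]_m -> 'F_2)
  (y : 'rV['F_2]_n) : R :=
  #|[set x : 'rV['F_2]_m | (\row_i P i x) == y]|%:R / 2%:R ^+ m.

Definition ber13 (R : realType) (n : nat) (y : 'rV['F_2]_n) : R :=
  \prod_(i < n) (if y 0 i == 1 then 1 / 3%:R else 2%:R / 3%:R).

Definition tv_dist (R : realType) (T : finType) (D1 D2 : T -> R) : R :=
  2%:R^-1 * \sum_(x : T) `|D1 x - D2 x|.

Definition log2 (R : realType) (x : R) : R := ln x / ln 2%:R.

(* Main.v *)
(** By hypothesis P_i is constant on the cosets of a subspace K_i of codimension
    at most r.  Given a subspace U, take a maximal family s of indices whose
    restrictions to every coset of U are independent.  If s is short, replace U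
    by its intersection with the K_i, i in s: this costs little codimension, and
    by maximality it lowers every codimension of U :&: K_i in U.  After at
    most r rounds one gets U of codimension D and an independent s of
    size at least 72 * 4^r * (D + T), with T about log n.  On each coset of U the
    bits P_i, i in s, are independent with biases in 2^-r Z, hence at distance at
    least 2^-r / 3 from 1/3; so the Hellinger affinity with Ber(1/3) is at most
    1 - 1/(72 * 4^r) per bit.  A union over the 2^D cosets bounds the
    overlap (the sum of min(P, Ber(1/3)^n)) by 2^-T <= 1/n, which is stronger than
    needed. *)
Require Import Defs.
From mathcomp Require Import all_boot all_order all_algebra fingroup mxabelem.
From mathcomp Require Import all_classical all_reals.
From mathcomp Require Import exp.
From mathcomp Require Import zify ring lra.
Import Order.TTheory GRing.Theory Num.Theory.
Local Open Scope ring_scope.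

(** * Linear algebra: selecting a long family of independent indices *)

Section Selection.
Set Implicit Arguments.
Unset Strict Implicit.
Variables (m n : nat) (K : 'I_n -> 'M['F_2]_m).
Implicit Types (U V : 'M['F_2]_m) (i : 'I_n) (s : seq 'I_n).

Definition cap_along U s : 'M['F_2]_m := foldr (fun i V => (V :&: K i)%MS) U s.

(* [indep_over U s] says that the maps U -> U/(U :&: K i), for i in s, are
   jointly onto; it is stated by adding one index at a time. *)
Fixpoint indep_over U s : bool :=
  if s is i :: s' then
    [&& i \notin s', (U <= cap_along U s' + U :&: K i)%MS & indep_over U s']
  else true.

Definition codim_in U i : nat := (\rank U - \rank (U :&: K i))%N.

Lemma indep_over_uniq U s : indep_over U s -> uniq s.
Proof. by elim: s => //= i s IHs /and3P[-> _ /IHs]. Qed.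

Lemma cap_along_sub U s : (cap_along U s <= U)%MS.
Proof. by elim: s => //= i s; apply: submx_trans; apply: capmxSl. Qed.

Lemma cap_along_sub_mem U s i : i \in s -> (cap_along U s <= K i)%MS.
Proof.
elim: s => //= j s IHs; rewrite inE => /orP[/eqP->|/IHs].
  exact: capmxSr.
by apply: submx_trans; apply: capmxSl.
Qed.

(** The quotient V/(V :&: K i) embeds in U/(U :&: K i), and the embedding is onto exactly when V and
    U :&: K i span U. So an index that fails the independence test strictly loses relative
    codimension. *)
Lemma codim_in_mono U V i : (V <= U)%MS ->
  (codim_in V i <= codim_in U i ?= iff (U <= V + U :&: K i)%MS)%N.
Proof.
move=> sVU.
have sub : (V + U :&: K i <= U)%MS by rewrite addsmx_sub sVU capmxSl.
have := mxrank_sum_cap V (U :&: K i)%MS.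
have -> : \rank (V :&: (U :&: K i)) = \rank (V :&: K i).
  apply: eqmx_rank.
  rewrite capmxS ?capmxSr ?submx_refl //= sub_capmx capmxSl sub_capmx capmxSr.
  by rewrite (submx_trans (capmxSl V (K i)) sVU).
have := mxrank_leqif_sup sub.
have := mxrankS (capmxSl V (K i)); have := mxrankS (capmxSl U (K i)).
rewrite /codim_in => h1 h2 [h3 h4] h5; split; first lia.
rewrite -h4; apply/eqP/eqP; lia.
Qed.

Lemma rank_capK U i d : (m <= \rank (K i) + d)%N -> (codim_in U i <= d)%N.
Proof.
move=> h; rewrite /codim_in; have := mxrank_sum_cap U (K i).
have := rank_leq_col (U + K i)%MS; lia.
Qed.

Lemma rank_cap_along U s d : (forall i, codim_in U i <= d)%N ->
  (\rank U <= \rank (cap_along U s) + d * size s)%N.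
Proof.
move=> h; elim: s => [|i s IHs] /=; first by rewrite muln0 addn0.
have [] := codim_in_mono i (cap_along_sub U s).
by have := h i; rewrite /codim_in; nia.
Qed.

Lemma greedy_indep U t : exists2 s, indep_over U s &
  size s = t \/ (size s < t)%N /\
  forall i, i \notin s -> ~~ (U <= cap_along U s + U :&: K i)%MS.
Proof.
elim: t => [|t [s inds [sz|[sz hmax]]]]; first by exists [::] => //; left.
  have [/existsP[i /andP[nis hi]]|/existsPn hmax] :=
      boolP [exists i, (i \notin s) && (U <= cap_along U s + U :&: K i)%MS].
    by exists (i :: s); [rewrite /= nis hi | left; rewrite /= sz].
  exists s => //; right; rewrite sz; split=> // i nis.
  by have := hmax i; rewrite nis.
by exists s => //; right; split=> //; apply: ltnW.
Qed.

Lemma indep_over_codim0 U s : uniq s -> (forall i, codim_in U i = 0)%N -> indep_over U s.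
Proof.
move=> us h; elim: s us => //= i s IHs /andP[-> /IHs ->]; rewrite andbT /=.
apply: submx_trans (addsmxSr _ _).
rewrite -(mxrank_leqif_sup (capmxSl U (K i))) eqn_leq mxrankS ?capmxSl //.
by have := h i; rewrite /codim_in; lia.
Qed.

(* Either a long independent family exists over [U], or a maximal one is short,
   and cutting [U] along it lowers every relative codimension. *)
Lemma exists_long_indep (M T d : nat) U :
  (0 < M)%N -> (forall i, codim_in U i <= d)%N ->
  (M * (1 + d * M) ^ d * ((m - \rank U) + T) <= n)%N ->
  exists V s, indep_over V s /\ (M * ((m - \rank V) + T) <= size s)%N.
Proof.
move=> M0; elim: d U => [|d IHd] U hU hn.
  (* With all relative codimensions zero, independence is automatic, so every index can be taken. *)
  exists U, (enum 'I_n); rewrite size_enum_ord; split; last by rewrite expn0 muln1 in hn.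
  apply: indep_over_codim0; first exact: enum_uniq.
  by move=> i; apply/eqP; rewrite -leqn0.
set D := ((m - \rank U) + T)%N in hn.
have [s inds [sz|[sz hmax]]] := greedy_indep U (M * D).
  by exists U, s; rewrite sz.
apply: (IHd (cap_along U s)).
  (* An index in [s] drops to relative codimension 0; any other drops by at least one, by maximality
     and the equality case of [codim_in_mono]. *)
  move=> i; have [hle heq] := codim_in_mono i (cap_along_sub U s).
  have [si|nsi] := boolP (i \in s).
    rewrite /codim_in (_ : \rank (cap_along U s :&: K i) = \rank (cap_along U s)) ?subnn //.
    by apply/eqmx_rank/eqmxP/capmx_idPl; apply: cap_along_sub_mem.
  have := hmax i nsi; have := hU i; rewrite -heq; lia.
have hr := rank_cap_along s hU.
apply: leq_trans hn.
have hb : (1 + d * M <= 1 + d.+1 * M)%N by nia.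
(* Cutting along fewer than M * D indices costs at most d.+1 each, so D grows by a factor of at most
   1 + d.+1 * M. *)
apply: (@leq_trans (M * (1 + d.+1 * M) ^ d * ((1 + d.+1 * M) * D))%N).
  apply: leq_mul.
    by rewrite leq_mul2l; apply/orP; right; case: (d) hb => // k hb; rewrite leq_exp2r.
  rewrite /D; nia.
by rewrite expnSr !mulnA.
Qed.

End Selection.

(** * Averages over cosets of a subspace *)

Section CosetMean.
Set Implicit Arguments.
Unset Strict Implicit.
Variables (R : realType) (m : nat).
Implicit Types (U V H : 'M['F_2]_m) (x u : 'rV['F_2]_m) (f : 'rV['F_2]_m -> R).

Definition invariant_under T H (f : 'rV['F_2]_m -> T) :=
  forall x u, (u <= H)%MS -> f (x + u) = f x.

(** Cosets are indexed by their points instead of by a quotient, so a sum over x counts each coset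
    #|rowg U| times. *)
Definition coset_mean U f x : R := #|rowg U|%:R^-1 * \sum_(u in rowg U) f (x + u).

Lemma card_rowg_gt0 U : 0 < #|rowg U|%:R :> R.
Proof. by rewrite ltr0n cardG_gt0. Qed.

Lemma sum_rowg_shift U f x u : (u <= U)%MS ->
  \sum_(v in rowg U) f (x + u + v) = \sum_(v in rowg U) f (x + v).
Proof.
move=> hu; rewrite [RHS](reindex_inj (addrI u)) /=.
apply: eq_big => [v|v _]; last by rewrite addrA.
by rewrite -[u + v]/(u * v)%g groupMl // mem_rowg.
Qed.

Lemma coset_mean_inv U f : invariant_under U (coset_mean U f).
Proof. by move=> x u hu; rewrite /coset_mean sum_rowg_shift. Qed.

Lemma coset_mean_const U (a : R) x : coset_mean U (fun=> a) x = a.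
Proof.
rewrite /coset_mean sumr_const -[a *+ _]mulr_natl mulrA mulVf ?mul1r //.
by rewrite gt_eqF ?card_rowg_gt0.
Qed.

Lemma eq_coset_mean U f g x : (forall z, f z = g z) -> coset_mean U f x = coset_mean U g x.
Proof. by move=> fg; congr (_ * _); apply: eq_bigr => u _. Qed.

Lemma coset_mean_ge0 U f x : (forall z, 0 <= f z) -> 0 <= coset_mean U f x.
Proof. by move=> f0; rewrite mulr_ge0 ?invr_ge0 ?ler0n // sumr_ge0. Qed.

Lemma coset_mean_le U f g x : (forall z, f z <= g z) -> coset_mean U f x <= coset_mean U g x.
Proof. by move=> fg; rewrite ler_wpM2l ?invr_ge0 ?ler0n // ler_sum. Qed.

Lemma coset_mean_sum (I : finType) (F : I -> 'rV['F_2]_m -> R) U x :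
  coset_mean U (fun z => \sum_i F i z) x = \sum_i coset_mean U (F i) x.
Proof. by rewrite /coset_mean exchange_big mulr_sumr. Qed.

Lemma coset_meanZ U a f x : coset_mean U (fun z => a * f z) x = a * coset_mean U f x.
Proof. by rewrite /coset_mean -mulr_sumr mulrCA. Qed.

Lemma sum_coset_mean U f : \sum_x coset_mean U f x = \sum_x f x.
Proof.
rewrite /coset_mean -mulr_sumr exchange_big /=.
rewrite (eq_bigr (fun=> \sum_x f x)) => [|u _]; last by rewrite [RHS](reindex_inj (addIr u)).
rewrite sumr_const -(mulr_natl (\sum_x f x)) mulrA mulVf ?mul1r //.
by rewrite gt_eqF ?card_rowg_gt0.
Qed.

(* Averaging over translates by u = v + h, with v in [V] and h in [H]: v can be
   moved from [f] to [F], which absorbs it, and h is absorbed by [f]. *)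
Lemma coset_meanM U V H F f x : (V <= U)%MS -> (U <= V + H)%MS ->
  invariant_under V F -> invariant_under H f ->
  coset_mean U (fun z => F z * f z) x = coset_mean U F x * coset_mean U f x.
Proof.
move=> sVU sUVH invF invf.
have shift u : (u <= U)%MS ->
    \sum_(z in rowg U) F (x + z) * f (x + z + u) = \sum_(z in rowg U) F (x + z) * f (x + z).
  move=> hu; have /sub_addsmxP[[a b] /= def_u] := submx_trans hu sUVH.
  have aV : (a *m V <= V)%MS by apply: submxMl.
  have bH : (b *m H <= H)%MS by apply: submxMl.
  have aU := submx_trans aV sVU.
  rewrite -[RHS](sum_rowg_shift (fun z => F z * f z) x aU); apply: eq_bigr => z _.
  by rewrite /= def_u addrA (invf _ _ bH) [x + a *m V + z]addrAC (invF _ _ aV).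
set A := \sum_(z in rowg U) F (x + z) * f (x + z).
have main : #|rowg U|%:R * A = (\sum_(z in rowg U) F (x + z)) * \sum_(z in rowg U) f (x + z).
  transitivity (\sum_(u in rowg U) A); first by rewrite sumr_const mulr_natl.
  rewrite mulr_suml (eq_bigr (fun u => \sum_(z in rowg U) F (x + z) * f (x + z + u))); last first.
    by move=> u; rewrite mem_rowg => /shift.
  rewrite exchange_big; apply: eq_bigr => z; rewrite mem_rowg => hz /=.
  by rewrite -mulr_sumr sum_rowg_shift.
rewrite /coset_mean mulrACA -main -/A; field.
by rewrite gt_eqF ?card_rowg_gt0.
Qed.

(** Linear independence becomes probabilistic independence: the product over the tail of [s] is
    invariant under [cap_along K U s], so [coset_meanM] splits off the head. *)
Lemma coset_mean_prod n (K : 'I_n -> 'M['F_2]_m) U s (f : 'I_n -> 'rV['F_2]_m -> R) x :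
  (forall i, invariant_under (K i) (f i)) -> indep_over K U s ->
  coset_mean U (fun z => \prod_(i <- s) f i z) x = \prod_(i <- s) coset_mean U (f i) x.
Proof.
move=> invf; elim: s => [|i s IHs] /=.
  rewrite big_nil -[RHS](coset_mean_const U 1 x) => _.
  by apply: eq_coset_mean => z; rewrite big_nil.
move=> /and3P[_ sub inds]; rewrite big_cons -IHs // mulrC.
rewrite -(@coset_meanM U (cap_along K U s) (U :&: K i)%MS) //.
- by apply: eq_coset_mean => z; rewrite big_cons mulrC.
- exact: cap_along_sub.
- move=> z u hu; apply: eq_big_seq => j sj.
  by apply: invf; apply: submx_trans hu _; apply: cap_along_sub_mem.
- by move=> z u; rewrite sub_capmx => /andP[_ hu]; apply: invf.
Qed.

(** The counted set is a union of cosets of [H]. This is what makes the biases dyadic. *)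
Lemma dvdn_card_invariant U H (b : pred 'rV['F_2]_m) x : (H <= U)%MS ->
  invariant_under H b -> (#|rowg H| %| #|[set u in rowg U | b (x + u)%R]|)%N.
Proof.
move=> sHU invb; set A := [set u in _ | _].
rewrite -[X in (_ %| X)%N]sum1_card (partition_big (fun u => (rowg H :* u)%g) predT) //=.
apply: dvdn_sum => B _; rewrite sum1dep_card.
have [->|[u0]] := set_0Vmem [set u in A | (rowg H :* u)%g == B]; first by rewrite cards0.
rewrite !inE => /andP[/andP[u0U bu0] /eqP defB].
suff -> : [set u in A | (rowg H :* u)%g == B] = (rowg H :* u0)%g by rewrite card_rcoset.
apply/setP=> u; rewrite -defB !inE (sameP eqP rcoset_eqP).
have [hu|] := boolP (u \in (rowg H :* u0)%g); last by rewrite andbF.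
have [h hH ->] := rcosetP hu; rewrite -[(h * u0)%g]/(h + u0).
have hH' : (h <= H)%MS by rewrite -mem_rowg.
rewrite (addmx_sub (submx_trans hH' sHU) u0U) /= andbT.
by rewrite addrCA addrC invb.
Qed.
End CosetMean.

(** * Hellinger affinity and the overlap with the product Bernoulli law *)

Section Overlap.
Variables (R : realType).
Set Implicit Arguments.
Unset Strict Implicit.

(** One minus the affinity is half the sum of the squared differences of the square roots. The
    second square is dropped, and p - q factors as a difference of square roots times their sum,
    which is at most 2. *)
Lemma bernoulli_affinity_le (p q : R) : 0 <= p <= 1 -> 0 <= q <= 1 ->
  Num.sqrt p * Num.sqrt q + Num.sqrt (1 - p) * Num.sqrt (1 - q) <= 1 - (p - q) ^+ 2 / 8%:R.
Proof.
move=> /andP[p0 p1] /andP[q0 q1].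
have sq (t : R) : 0 <= t <= 1 -> [/\ 0 <= Num.sqrt t, Num.sqrt t <= 1 & Num.sqrt t ^+ 2 = t].
  move=> /andP[t0 t1]; rewrite sqrtr_ge0 sqr_sqrtr //; split=> //.
  by rewrite -[leRHS]sqrtr1 ler_wsqrtr.
have [s0 s1 sE] : [/\ 0 <= Num.sqrt p, Num.sqrt p <= 1 & Num.sqrt p ^+ 2 = p] by apply: sq; lra.
have [t0 t1 tE] : [/\ 0 <= Num.sqrt q, Num.sqrt q <= 1 & Num.sqrt q ^+ 2 = q] by apply: sq; lra.
have [_ _ uE] := sq (1 - p) ltac:(lra); have [_ _ vE] := sq (1 - q) ltac:(lra).
set s := Num.sqrt p in s0 s1 sE *; set t := Num.sqrt q in t0 t1 tE *.
set u := Num.sqrt _ in uE *; set v := Num.sqrt _ in vE *.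
have h1 : (p - q) ^+ 2 <= 4%:R * (s - t) ^+ 2.
  have -> : (p - q) ^+ 2 = (s + t) ^+ 2 * (s - t) ^+ 2 by rewrite -sE -tE; ring.
  by rewrite ler_wpM2r ?sqr_ge0 //; nra.
have h2 : 0 <= (u - v) ^+ 2 := sqr_ge0 _.
nra.
Qed.

Definition bern13 (b : 'F_2) : R := if b == 1 then 1 / 3%:R else 2%:R / 3%:R.

Lemma bern13_gt0 b : 0 < bern13 b.
Proof. by rewrite /bern13; case: ifP => _; lra. Qed.

Lemma sum_F2 (f : 'F_2 -> R) : \sum_b f b = f 0 + f 1.
Proof.
rewrite (bigD1 0) //= (bigD1 1) //= big1 ?addr0 // => b.
by case: b => [[|[|b]] hb] //=.
Qed.

Lemma dyadic_affinity_le (p : 'F_2 -> R) (r a : nat) :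
  (forall b, 0 <= p b) -> \sum_b p b = 1 -> p 1 * 2%:R ^+ r = a%:R ->
  \sum_b Num.sqrt (p b) * Num.sqrt (bern13 b) <= 1 - (72 * 4 ^ r)%:R^-1.
Proof.
move=> p_ge0; rewrite !sum_F2 => p_sum pE; have := p_ge0 0; have := p_ge0 1 => h1 h0.
have -> : bern13 0 = 1 - 1 / 3%:R by rewrite /bern13 /=; lra.
have -> : bern13 1 = 1 / 3%:R by rewrite /bern13 eqxx.
have -> : p 0 = 1 - p 1 by lra.
rewrite addrC; apply: le_trans (bernoulli_affinity_le _ _) _; [lra|lra|].
have r0 : 0 < 2%:R ^+ r :> R by rewrite exprn_gt0 // ltr0n.
(* Since 3 does not divide 2^r, the integer 3a - 2^r is nonzero; hence p 1 is at least 1/(3 * 2^r)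
   away from 1/3, and 72 is 8 * 9. *)
have key : 1 <= (3%:R * a%:R - 2%:R ^+ r) ^+ 2 :> R.
  have : 1 <= ((3 * a)%:Z - (2 ^ r)%:Z) ^+ 2.
    have ndvd : ~~ (3 %| 2 ^ r)%N by rewrite Euclid_dvdX.
    have : ((3 * a)%N != (2 ^ r)%N) by apply: contraNneq ndvd => <-; apply: dvdn_mulr.
    nia.
  have -> : 3%:R * a%:R - 2%:R ^+ r = ((3 * a)%:Z - (2 ^ r)%:Z)%:~R :> R.
    by rewrite rmorphB /= -!pmulrn natrM natrX.
  by rewrite -rmorphXn /= ler1z.
have e4 : (72 * 4 ^ r)%:R = 72%:R * (2%:R ^+ r) ^+ 2 :> R.
  by rewrite natrM natrX -!exprM mulnC exprM; congr (_ * _ ^+ _); rewrite -natrX.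
rewrite e4 lerD2l lerN2 -[leLHS]mulr1 ler_pdivrMl; last by nra.
move: pE key r0; set T := 2%:R ^+ r => pE key r0.
rewrite -pE in key; nra.
Qed.

Lemma sum_prod_row n (F : 'I_n -> 'F_2 -> R) :
  \sum_(y : 'rV['F_2]_n) \prod_i F i (y 0 i) = \prod_i \sum_b F i b.
Proof.
rewrite bigA_distr_bigA /= (reindex (fun f : {ffun 'I_n -> 'F_2} => \row_i f i)) /=.
  by apply: eq_bigr => f _; apply: eq_bigr => i _; rewrite mxE.
exists (fun y : 'rV_n => [ffun i => y 0 i]) => [f _|y _].
  by apply/ffunP=> i; rewrite ffunE mxE.
by apply/rowP=> i; rewrite mxE ffunE.
Qed.

Lemma sum_ber13 n : \sum_y @ber13 R n y = 1.
Proof.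
rewrite /ber13 (sum_prod_row (fun _ => bern13)) big1 // => i _.
by rewrite sum_F2 /bern13 /=; lra.
Qed.

Lemma ber13_ge0 n (y : 'rV['F_2]_n) : 0 <= ber13 R y.
Proof. by apply: prodr_ge0 => i _; apply/ltW/bern13_gt0. Qed.

Lemma tv_dist_overlap (T : finType) (D1 D2 : T -> R) :
  \sum_x D1 x = 1 -> \sum_x D2 x = 1 ->
  tv_dist D1 D2 = 1 - \sum_x Num.min (D1 x) (D2 x).
Proof.
move=> h1 h2; rewrite /tv_dist.
rewrite (eq_bigr (fun x => D1 x + D2 x - 2%:R * Num.min (D1 x) (D2 x))).
  by rewrite sumrB big_split /= h1 h2 -mulr_sumr; lra.
by move=> x _; case: (leP (D1 x) (D2 x)) => h; [rewrite ler0_norm | rewrite gtr0_norm]; lra.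
Qed.

Variables (m n : nat) (K : 'I_n -> 'M['F_2]_m) (P : 'I_n -> 'rV['F_2]_m -> 'F_2).
Hypothesis invP : forall i, invariant_under (K i) (P i).
Variable U : 'M['F_2]_m.

Definition coset_law (x : 'rV['F_2]_m) (y : 'rV['F_2]_n) : R :=
  coset_mean U (fun z => ((\row_i P i z) == y)%:R) x.

Definition coset_bit x i b : R := coset_mean U (fun z => (P i z == b)%:R) x.

Definition coset_affinity x i : R :=
  \sum_b Num.sqrt (coset_bit x i b) * Num.sqrt (bern13 b).

Lemma coset_bit_ge0 x i b : 0 <= coset_bit x i b.
Proof. by apply: coset_mean_ge0 => z; apply: ler0n. Qed.

Lemma coset_law_ge0 x y : 0 <= coset_law x y.
Proof. by apply: coset_mean_ge0 => z; apply: ler0n. Qed.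

Lemma coset_mean_comp (I : finType) (Q : 'rV['F_2]_m -> I) (h : I -> R) x :
  coset_mean U (fun z => h (Q z)) x =
  \sum_b h b * coset_mean U (fun z => (Q z == b)%:R) x.
Proof.
under eq_bigr => b _ do rewrite -coset_meanZ.
rewrite -coset_mean_sum; apply: eq_coset_mean => z.
rewrite (bigD1 (Q z)) //= eqxx mulr1 big1 ?addr0 // => b.
by rewrite eq_sym => /negbTE ->; rewrite mulr0.
Qed.

Lemma sum_coset_bit x i : \sum_b coset_bit x i b = 1.
Proof.
rewrite -[RHS](coset_mean_const U 1 x) (coset_mean_comp (P i) (fun=> 1)).
by apply: eq_bigr => b _; rewrite mul1r.
Qed.

Lemma coset_affinity_le r x i : (codim_in K U i <= r)%N ->
  coset_affinity x i <= 1 - (72 * 4 ^ r)%:R^-1.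
Proof.
move=> hr.
have inv1 : invariant_under (U :&: K i)%MS (fun z => P i z == 1).
  by move=> z u; rewrite sub_capmx => /andP[_ hu]; rewrite invP.
have /dvdnP[a ha] := dvdn_card_invariant x (capmxSl U (K i)) inv1.
(* The bias is a / 2^(codim_in K U i), rescaled here to the common denominator 2^r. *)
apply: (@dyadic_affinity_le (coset_bit x i) r (a * 2 ^ (r - codim_in K U i))).
- by move=> b; apply: coset_bit_ge0.
- exact: sum_coset_bit.
rewrite /coset_bit /coset_mean -natr_sum /= -big_mkcondr sum1dep_card /=.
have -> : #|rowg U| = (2 ^ codim_in K U i * #|rowg (U :&: K i)%MS|)%N.
  rewrite !card_rowg card_Fp // -expnD; congr (_ ^ _)%N.
  by rewrite /codim_in subnK // mxrankS ?capmxSl.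
rewrite ha -{1}(subnKC hr) exprD !natrM !natrX.
have := card_rowg_gt0 R (U :&: K i)%MS => c0.
field; rewrite gt_eqF //= expf_neq0 // pnatr_eq0 //.
Qed.

(** For G > 0, AM-GM gives min(p, q) <= (G q + p / G) / 2. With G the root of the likelihood ratio
    on the bits in [s], both terms sum to the product of affinities: the first because the Bernoulli
    law is a product, the second by independence over [s]. *)
Lemma coset_overlap_le s x : indep_over K U s ->
  \sum_y Num.min (coset_law x y) (ber13 R y) <= \prod_(i <- s) coset_affinity x i.
Proof.
move=> inds; have us := indep_over_uniq inds.
(* The square root of the likelihood ratio on the bits in s. *)
pose g i b : R := Num.sqrt (coset_bit x i b) / Num.sqrt (bern13 b).
pose G (y : 'rV['F_2]_n) := \prod_(i <- s) g i (y 0 i).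
have sb_gt0 b : 0 < Num.sqrt (bern13 b) by rewrite sqrtr_gt0 bern13_gt0.
have g_ge0 i b : 0 <= g i b by rewrite divr_ge0 ?sqrtr_ge0.
have G_ge0 y : 0 <= G y by apply: prodr_ge0.
have sumG : \sum_y G y * ber13 R y = \prod_(i <- s) coset_affinity x i.
  transitivity (\sum_(y : 'rV['F_2]_n) \prod_i
      ((if i \in s then g i (y 0 i) else 1) * bern13 (y 0 i))).
    by apply: eq_bigr => y _; rewrite big_split /= -big_mkcond -big_uniq.
  rewrite (sum_prod_row (fun i b => (if i \in s then g i b else 1) * bern13 b)).
  rewrite (big_uniq _ us) [RHS]big_mkcond; apply: eq_bigr => i _.
  case: ifP => _; last by rewrite sum_F2 /bern13 /=; lra.
  apply: eq_bigr => b _; rewrite -{1}(sqr_sqrtr (ltW (bern13_gt0 b))) /g.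
  by field; rewrite gt_eqF.
have sumGV : \sum_y (G y)^-1 * coset_law x y = \prod_(i <- s) coset_affinity x i.
  rewrite -(coset_mean_comp (fun z => \row_i P i z) (fun y => (G y)^-1)).
  transitivity (coset_mean U (fun z => \prod_(i <- s) (g i (P i z))^-1) x).
    apply: eq_coset_mean => z; rewrite prodfV; congr (_^-1).
    by apply: eq_bigr => i _; rewrite mxE.
  rewrite (coset_mean_prod x _ inds); last by move=> i z u hu; rewrite invP.
  apply: eq_bigr => i _.
  rewrite (coset_mean_comp (P i) (fun b => (g i b)^-1)); apply: eq_bigr => b _.
  rewrite -/(coset_bit x i b) /g.
  have [->|p0] := eqVneq (coset_bit x i b) 0; first by rewrite sqrtr0 mulr0 mul0r.
  have sp : 0 < Num.sqrt (coset_bit x i b) by rewrite sqrtr_gt0 lt0r p0 coset_bit_ge0.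
  rewrite -{2}(sqr_sqrtr (coset_bit_ge0 x i b)).
  by field; rewrite !gt_eqF.
(* With M the minimum, the right-hand side is at least (G + 1/G) M / 2 >= M. *)
have bound y : Num.min (coset_law x y) (ber13 R y) <=
    2%:R^-1 * (G y * ber13 R y + (G y)^-1 * coset_law x y).
  (* [G y] may vanish when the law does, so that case is separate. Where the law is positive, so is
     the mass of each bit, and [G y] is invertible. *)
  have [law0|lawn0] := eqVneq (coset_law x y) 0.
    by rewrite law0 mulr0 addr0 (min_idPl (ber13_ge0 y)) !mulr_ge0 ?ber13_ge0 ?invr_ge0.
  have law_gt0 : 0 < coset_law x y by rewrite lt0r lawn0 coset_law_ge0.
  have Gpos : 0 < G y.
    apply: prodr_gt0 => i _; rewrite divr_gt0 // sqrtr_gt0.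
    apply: lt_le_trans law_gt0 _; apply: coset_mean_le => z.
    rewrite ler_nat; case: eqP => // <-.
    by rewrite mxE eqxx.
  set M := Num.min _ _.
  have M1 : M <= coset_law x y by rewrite ge_min lexx.
  have M2 : M <= ber13 R y by rewrite ge_min lexx orbT.
  have M0 : 0 <= M by rewrite le_min ber13_ge0 coset_law_ge0.
  have G2 : 2%:R <= G y + (G y)^-1.
    have := mulfV (lt0r_neq0 Gpos); set a := G y in Gpos *.
    have : 0 < a^-1 by rewrite invr_gt0.
    set b := a^-1; have := sqr_ge0 (a - b); nra.
  have h1 : G y * M <= G y * ber13 R y by rewrite ler_wpM2l.
  have h2 : (G y)^-1 * M <= (G y)^-1 * coset_law x y by rewrite ler_wpM2l ?invr_ge0.
  nra.
apply: le_trans (ler_sum _ (fun y _ => bound y)) _.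
by rewrite -mulr_sumr big_split /= sumG sumGV; lra.
Qed.

Lemma push_dist_mean y : push_dist R P y = (2%:R ^+ m)^-1 * \sum_x coset_law x y.
Proof.
rewrite /coset_law sum_coset_mean /push_dist mulrC; congr (_ * _).
by rewrite -natr_sum -big_mkcond sum1dep_card.
Qed.

Lemma sum_push_dist : \sum_y push_dist R P y = 1.
Proof.
under eq_bigr => y _ do rewrite push_dist_mean.
rewrite -mulr_sumr exchange_big /=.
rewrite (eq_bigr (fun=> 1)) => [|x _].
  rewrite sumr_const card_mx card_Fp // mul1n natrX mulVf // expf_neq0 //.
  by rewrite pnatr_eq0.
rewrite -[RHS](coset_mean_const U 1 x) (coset_mean_comp (fun z => \row_i P i z) (fun=> 1)).
by apply: eq_bigr => b _; rewrite mul1r.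
Qed.

(* Each coset of [U] occurs #|rowg U| times in the sum over x. *)
Lemma min_push_dist_le y : Num.min (push_dist R P y) (ber13 R y) <=
  #|rowg U|%:R^-1 * \sum_x Num.min (coset_law x y) (ber13 R y).
Proof.
have U0 := card_rowg_gt0 R U.
(* If the Bernoulli mass is the minimum on some coset, that coset alone accounts for it. Otherwise
   the minimum is the coset law everywhere, and #|rowg U| <= 2^m suffices. *)
have [/existsP[x hx]|/existsPn hlt] := boolP [exists x, ber13 R y <= coset_law x y].
  rewrite ge_min; apply/orP; right; rewrite ler_pdivlMl //.
  apply: (@le_trans _ _ (\sum_(u in rowg U) Num.min (coset_law (x + u) y) (ber13 R y))).
    rewrite mulr_natl -sumr_const; apply: ler_sum => u; rewrite mem_rowg => hu.
    by rewrite /coset_law coset_mean_inv // le_min lexx andbT.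
  rewrite [leRHS](reindex_inj (addrI x)) [leRHS](bigID (mem (rowg U))) /=.
  rewrite lerDl; apply: sumr_ge0 => u _.
  by rewrite le_min coset_law_ge0 ber13_ge0.
rewrite ge_min push_dist_mean; apply/orP; left; apply: ler_pM.
- by rewrite invr_ge0 exprn_ge0 ?ler0n.
- by apply: sumr_ge0 => x _; apply: coset_law_ge0.
- rewrite lef_pV2 ?posrE ?exprn_gt0 ?ltr0n //.
  by rewrite -natrX ler_nat card_rowg card_Fp // leq_pexp2l // rank_leq_col.
apply: ler_sum => x _; rewrite le_min lexx /=.
by have := hlt x; rewrite -ltNge => /ltW.
Qed.

Lemma overlap_le r s : indep_over K U s -> (forall i, codim_in K U i <= r)%N ->
  \sum_y Num.min (push_dist R P y) (ber13 R y) <=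
  2%:R ^+ (m - \rank U) * (1 - (72 * 4 ^ r)%:R^-1) ^+ size s.
Proof.
move=> inds hr; set rho := 1 - _.
apply: le_trans (ler_sum _ (fun y _ => min_push_dist_le y)) _.
rewrite -mulr_sumr exchange_big /=.
have hx x : \sum_y Num.min (coset_law x y) (ber13 R y) <= rho ^+ size s.
  apply: le_trans (coset_overlap_le x inds) _.
  have -> : rho ^+ size s = \prod_(i <- s) rho by rewrite big_const_seq count_predT iter_mulr_1.
  apply: ler_prod => i _.
  rewrite coset_affinity_le // andbT.
  by apply: sumr_ge0 => b _; rewrite mulr_ge0 ?sqrtr_ge0.
apply: (@le_trans _ _ (#|rowg U|%:R^-1 * \sum_(x : 'rV['F_2]_m) rho ^+ size s)).
  by rewrite ler_wpM2l ?invr_ge0 ?ler0n // ler_sum.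
rewrite sumr_const card_mx card_rowg card_Fp // mul1n -(mulr_natl (rho ^+ _)) mulrA.
(* This factor is the number of cosets of [U]. *)
suff -> : (2 ^ \rank U)%:R^-1 * (2 ^ m)%:R = 2%:R ^+ (m - \rank U) :> R by [].
have -> : (2 ^ m = 2 ^ (m - \rank U) * 2 ^ \rank U)%N by rewrite -expnD subnK ?rank_leq_col.
rewrite natrM !natrX.
by field; rewrite expf_neq0 // pnatr_eq0.
Qed.
End Overlap.

(** * From rank to an invariant subspace *)

Section Rank1.
Set Implicit Arguments.
Unset Strict Implicit.

Lemma rank1_invariant (m r : nat) (P : 'rV['F_2]_m -> 'F_2) : (rank1 P <= r)%N ->
  exists2 K : 'M['F_2]_m, (m <= \rank K + r)%N & invariant_under K P.
Proof.
rewrite /rank1; case: ex_minnP => k /andP[_ /existsP[L /existsP[G /forallP defP]]] _ kr.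
pose A : 'M['F_2]_(m, k) := \matrix_(a, j) (L j).1 0 a.
have evalE x : \row_j aff_eval (L j).1 (L j).2 x = \row_j (L j).2 + x *m A.
  apply/rowP=> j; rewrite !mxE; congr (_ + _); apply: eq_bigr => a _.
  by rewrite mxE mulrC.
(* The common kernel of the linear parts: translating by it changes none of the affine forms. *)
exists (kermx A) => [|x u /sub_kermxP uA].
  by rewrite mxrank_ker; have := rank_leq_col A; lia.
by rewrite (eqP (defP _)) (eqP (defP x)) !evalE mulmxDl uA addr0.
Qed.
End Rank1.

(** * Numerical estimates *)

Section Numerics.
Variable R : realType.
Set Implicit Arguments.
Unset Strict Implicit.

(** With x = 1/M, Bernoulli's inequality gives (1 + x)^M >= 2, while (1 - x)^M (1 + x)^M <= 1. *)
Lemma exprn_oneB_inv_le (M : nat) : (0 < M)%N -> (1 - M%:R^-1) ^+ M <= 2%:R^-1 :> R.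
Proof.
move=> M0; set x := M%:R^-1.
have Mx : M%:R * x = 1 :> R by rewrite mulfV // pnatr_eq0 -lt0n.
have x0 : 0 < x by rewrite invr_gt0 ltr0n.
have x1 : x <= 1 by rewrite invf_le1 ?ltr0n // ler1n.
have bernoulli k : 1 + k%:R * x <= (1 + x) ^+ k.
  elim: k => [|k IHk]; first by rewrite mul0r addr0 expr0.
  rewrite exprS -natr1; have : 0 <= k%:R :> R by rewrite ler0n.
  by move=> k0; apply: le_trans (ler_wpM2l _ IHk); nra.
have := bernoulli M; rewrite Mx => h2.
have h1 : (1 - x) ^+ M * (1 + x) ^+ M <= 1.
  by rewrite -exprMn exprn_ile1; nra.
have h0 : 0 <= (1 - x) ^+ M by rewrite exprn_ge0 // subr_ge0.
nra.
Qed.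

(** Every M factors give a half: D of these halves cancel the number of cosets and T remain. *)
Lemma exprn_decay (M D T t : nat) : (0 < M)%N -> (M * (D + T) <= t)%N ->
  2%:R ^+ D * (1 - M%:R^-1) ^+ t <= (2%:R ^+ T)^-1 :> R.
Proof.
move=> M0 ht; set rho := 1 - _.
have r0 : 0 <= rho by rewrite subr_ge0 invf_le1 ?ltr0n // ler1n.
have r1 : rho <= 1 by rewrite lerBlDr lerDl invr_ge0 ler0n.
apply: (@le_trans _ _ (2%:R ^+ D * (2%:R^-1) ^+ (D + T))).
  rewrite ler_wpM2l ?exprn_ge0 ?ler0n //.
  apply: le_trans (ler_wiXn2l _ _ ht) _ => //.
  by rewrite exprM lerXn2r ?nnegrE ?exprn_ge0 ?invr_ge0 ?ler0n ?exprn_oneB_inv_le.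
by rewrite exprD mulrA -exprMn mulfV ?pnatr_eq0 // expr1n mul1r exprVn.
Qed.

(** The left side is at most 2 to the power 9r + 10r^2 + L/2, where the last term absorbs the factor
    L + 1. As 9r + 10r^2 <= 19r^2 and L >= 49r^2, the exponent is at most L. *)
Lemma schedule_le (n r : nat) : (1 <= r)%N -> (2 ^ (49 * r ^ 2) <= n)%N ->
  (72 * 4 ^ r * (1 + r * (72 * 4 ^ r)) ^ r * (trunc_log 2 n).+1 <= n)%N.
Proof.
move=> r1 hn; set L := trunc_log 2 n.
have n0 : (0 < n)%N by apply: leq_trans hn; rewrite expn_gt0.
have /andP[hL _] := trunc_log_bounds (isT : 1 < 2)%N n0.
have L49 : (49 * r ^ 2 <= L)%N by rewrite trunc_log_max.
set M := (72 * 4 ^ r)%N.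
have M_le : (M <= 2 ^ (9 * r))%N.
  rewrite /M (_ : 9 * r = 7 * r + 2 * r)%N; last lia.
  rewrite expnD (expnM 2 2); apply: leq_mul => //.
  by rewrite (@leq_trans (2 ^ 7)) // leq_exp2l //; lia.
have step_le : (1 + r * M <= 2 ^ (10 * r))%N.
  have hr : (r < 2 ^ r)%N by apply: ltn_expl.
  have M0 : (0 < M)%N by rewrite muln_gt0 expn_gt0.
  rewrite (_ : 10 * r = r + 9 * r)%N; last lia.
  rewrite expnD; apply: leq_trans (leq_mul hr M_le); nia.
have L_le : (L.+1 <= 2 ^ L./2)%N.
  have h k : (3 <= k -> 2 * k + 2 <= 2 ^ k)%N.
    by elim: k => // k IHk; rewrite leq_eqVlt => /orP[/eqP <- //|/IHk]; rewrite expnS; lia.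
  by apply: leq_trans (h L./2 _); nia.
apply: leq_trans hL.
apply: (@leq_trans (2 ^ (9 * r) * (2 ^ (10 * r)) ^ r * 2 ^ L./2)).
  by do 2![apply: leq_mul => //]; rewrite leq_exp2r.
by rewrite -expnM -!expnD leq_exp2l //; nia.
Qed.

Lemma log2_sqrt_bound (n r : nat) : (0 < n)%N -> (1 <= r)%N ->
  r%:R <= 7%:R^-1 * Num.sqrt (log2 n%:R) :> R -> (2 ^ (49 * r ^ 2) <= n)%N.
Proof.
move=> n0 r1 hr.
have ln2 : 0 < ln 2%:R :> R by rewrite ln_gt0 // ltr1n.
have l0 : 0 <= log2 n%:R :> R by rewrite divr_ge0 ?ln_ge0 ?ler1n // ltW.
have r0 : 0 <= r%:R :> R by rewrite ler0n.
have h : 49%:R * r%:R ^+ 2 <= log2 n%:R :> R.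
  rewrite -(sqr_sqrtr l0); set w := Num.sqrt _ in hr *.
  have w0 : 0 <= w by apply: sqrtr_ge0.
  nra.
rewrite -(ler_nat R) -ler_ln ?posrE ?ltr0n ?expn_gt0 // natrX lnXn ?ltr0n //.
by rewrite -(mulr_natl (ln _)) -ler_pdivlMr // natrM natrX.
Qed.

(** The left side is at most 1/n, the exponent 1/(r + 1) is at most 1, and the power of 2 in the
    numerator is at least 1. *)
Lemma error_le (n r T : nat) : (0 < n)%N -> (n <= 2 ^ T)%N ->
  (2%:R ^+ T)^-1 <= 1 * (2%:R `^ (r%:R / 2%:R)) / (n%:R `^ (1 / (r%:R + 1))) :> R.
Proof.
move=> n0 hT.
have n1 : 1 <= n%:R :> R by rewrite ler1n.
have p0 : 0 < n%:R `^ (1 / (r%:R + 1)) :> R by rewrite powR_gt0 // ltr0n.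
have e1 : 1 / (r%:R + 1) <= 1 :> R by rewrite ler_pdivrMr ?mul1r ?lerDr ?ltr_wpDl ?ler0n.
rewrite mul1r; apply: (@le_trans _ _ (1 / n%:R `^ (1 / (r%:R + 1)))); last first.
  rewrite ler_pM2r ?invr_gt0 // -[leLHS](powRr0 2%:R) ler_powR ?ler1n //.
  by rewrite divr_ge0 ?ler0n.
rewrite mul1r lef_pV2 ?posrE ?exprn_gt0 ?ltr0n //.
apply: (@le_trans _ _ n%:R); last by rewrite -natrX ler_nat.
by rewrite -[leRHS]powRr1 ?ler0n // ler_powR.
Qed.
End Numerics.

Theorem theorem8p6 (R : realType) :
  exists c C : R, 0 < c /\ 0 < C /\
  forall (n m r : nat) (P : 'I_n -> 'rV['F_2]_m -> 'F_2),
    (0 < n)%N -> (1 <= r)%N ->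
    r%:R <= c * Num.sqrt (log2 n%:R) ->
    (forall i, (rank1 (P i) <= r)%N) ->
    tv_dist (push_dist R P) (@ber13 R n) >=
      1 - C * (2%:R `^ (r%:R / 2%:R)) / (n%:R `^ (1 / (r%:R + 1))).
Proof.
(* Squaring c = 1/7 yields the 49 of [schedule_le]; C = 1 suffices because the overlap is at most
   1/n. *)
exists 7%:R^-1, 1; rewrite invr_gt0 ltr0n ltr01; do 2!split=> //.
move=> n m r P n0 r1 hr rkP.
have hn := log2_sqrt_bound n0 r1 hr.
have /fin_all_exists2[K rkK invP] : forall i, exists2 K : 'M['F_2]_m,
    (m <= \rank K + r)%N & invariant_under K (P i).
  by move=> i; apply: rank1_invariant.
have codim_le V i : (codim_in K V i <= r)%N by apply: rank_capK.
set M := (72 * 4 ^ r)%N; have M0 : (0 < M)%N by rewrite muln_gt0 expn_gt0.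
set T := (trunc_log 2 n).+1.
have nT : (n <= 2 ^ T)%N.
  by have /andP[_ /ltnW] := trunc_log_bounds (isT : 1 < 2)%N n0.
(* The selection starts from the full space, of codimension 0, so only [T] enters the initial
   budget. *)
have budget : (M * (1 + r * M) ^ r * ((m - \rank (1%:M : 'M['F_2]_m)) + T) <= n)%N.
  by rewrite mxrank1 subnn add0n; apply: schedule_le.
have [V [s [inds long]]] := exists_long_indep M0 (codim_le 1%:M) budget.
rewrite tv_dist_overlap ?sum_ber13 ?(sum_push_dist R P V) // lerD2l lerN2.
apply: le_trans (overlap_le R invP inds (codim_le V)) _.
apply: le_trans (exprn_decay R M0 long) _.
exact: error_le.
Qed.
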